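(* Let $(E,\|\cdot\|)$ be a normed vector space and let $X$ be a Polish space. Let $C$ be a convex subset of $E$ which is complete for the metric $d_{\|\cdot\|}$. Suppose $F:X\to\mathcal F^*_{\mathrm{conv}}(C)$ is a lower continuous map. Then there is a continuous selection for $F$, namely a continuous map $f:X\to C$ such that $f(x)\in F(x)$ for all $x\in X$.
   Context: The metric $d_{\|\cdot\|}$ on $E$ is $d_{\|\cdot\|}(v,w)=\|v-w\|$; it is not required to be complete on $E$, only on $C$. $C$ carries the norm topology. $\mathcal F^*_{\mathrm{conv}}(C)$ denotes the set of non-empty convex closed subsets of $C$. A map $F:X\to\mathcal F^*_{\mathrm{conv}}(C)$ is lower continuous if it is continuous for the lower topology, i.e. the topology generated by the sets $\{A: A\cap U\neq\emptyset\}$ with $U\subseteq C$ open; equivalently, $\{x\in X: F(x)\cap U\neq\emptyset\}$ is open in $X$ for every open $U\subseteq C$. A Polish space is a separable topological space whose topology admits a compatible complete metric. *)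

(* Defs.v *)
From HB Require Import structures.
From mathcomp Require Import all_boot all_order all_algebra.
From mathcomp Require Import all_classical all_reals all_analysis.

Set Implicit Arguments.
Unset Strict Implicit.
Unset Printing Implicit Defensive.

Import Order.TTheory GRing.Theory Num.Theory.
Import numFieldNormedType.Exports.

Local Open Scope classical_set_scope.
Local Open Scope ring_scope.

Section Metrics.
Context {R : realType} {T : Type}.
Implicit Type d : T -> T -> R.

Definition is_metric d :=
  [/\ forall x y, d x y = 0 <-> x = y,
      forall x y, d x y = d y x &
      forall x y z, d x z <= d x y + d y z].

Definition cauchy_for d (u : T^nat) :=
  forall e, 0 < e -> \forall m & n \near \oo, d (u m) (u n) < e.

(* Completeness is stated for a distance on a bare type, rather than through
   completeType or completePseudoMetricType, because those require a pointed
   carrier and would exclude the empty space. *)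
Definition complete_for d :=
  forall u, cauchy_for d u -> exists l, d (u n) l @[n --> \oo] --> (0 : R).

End Metrics.

(* The axioms of is_metric imply 0 <= d, and nbhs_ball_ turns balls into
   neighborhood filters: d induces the topology of X. *)
Definition compatible_metric (R : realType) (X : topologicalType)
    (d : X -> X -> R) :=
  is_metric d /\ nbhs = nbhs_ball_ (fun x e => [set y | d x y < e]).

Definition separable (X : topologicalType) :=
  exists2 D : set X, countable D & dense D.

Definition polish (R : realType) (X : topologicalType) :=
  separable X /\ exists2 d : X -> X -> R, compatible_metric d & complete_for d.

Definition norm_dist (R : realType) (E : normedModType R) (v w : E) : R :=
  `|v - w|.

(* A subset C of E used as a type denotes {x : E | x \in C}, which carries the
   topology induced from E. *)
Definition complete_set (R : realType) (E : normedModType R) (C : set E) :=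
  complete_for (fun v w : C => norm_dist (\val v) (\val w)).

Definition convex_closed_sets (R : realType) (E : normedModType R)
    (C : set E) : set (set C) :=
  [set A : set C | [/\ A !=set0, closed A &
                       @convex_set R E [set \val v | v in A]]].
Arguments convex_closed_sets {R E} C _.

(* An alias of the set_type, so that it can be given the lower topology. *)
Definition Fconv (R : realType) (E : normedModType R) (C : set E) : Type :=
  set_type (convex_closed_sets C).

Section LowerTopology.
Context {R : realType} {E : normedModType R} (C : set E).

HB.instance Definition _ := Choice.copy (Fconv C) (set_type (convex_closed_sets C)).

Definition hit (U : set C) : set (Fconv C) :=
  [set A | (\val A : set C) `&` U !=set0].

HB.instance Definition _ :=
  isSubBaseTopological.Build (Fconv C) [set U : set C | open U] hit.

Lemma lower_continuousP (X : topologicalType) (F : X -> Fconv C) :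
  continuous F <->
  forall U : set C, open U -> open [set x | (\val (F x) : set C) `&` U !=set0].
Proof.
split=> [/continuousP cF U oU|oF].
  have := cF (hit U); apply.
  exists [set hit U]; last by rewrite bigcup_set1.
  by move=> _ ->; exact: (@finI_from1 _ _ [set V : set C | open V] hit U).
apply/continuousP => _ [D' sD <-]; rewrite preimage_bigcup.
apply: bigcup_open => B /sD[I sI <-].
rewrite preimage_bigcap openE => x FIx; apply: filter_bigI => U UI.
by apply: open_nbhs_nbhs; split; [exact/oF/set_mem/sI|exact: FIx].
Qed.

End LowerTopology.

(* Main.v *)
Require Import Defs.
From mathcomp Require Import all_boot all_order all_algebra.
From mathcomp Require Import all_classical all_reals all_analysis.
From mathcomp Require Import ring lra.

Import Order.TTheory GRing.Theory Num.Theory.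
Import numFieldNormedType.Exports.

Local Open Scope classical_set_scope.
Local Open Scope ring_scope.

(** This is Michael's selection theorem.

    The first ingredient is a continuous selection up to an error [e]
    ([approximate_selection]). Lower continuity says precisely that, for
    each point [c] of [C], the set of those [x] whose value meets the ball of
    radius [e] around [c] is open. These open sets cover [X], so a countable
    locally finite partition of unity subordinate to them lets one average the
    corresponding centers; at [x], all the centers that are given positive
    weight lie in the [e]-neighborhood of [F x], which is convex, hence so does
    their mean. Separability of [X] makes the cover countable through the balls
    around a dense sequence ([separable_subordinate_functions]), and local
    finiteness is then arranged by pushing each function down wherever earlier
    ones are already large ([locally_finite_refinement]).

    The second ingredient is an iteration
    ([approximate_selection_sequence]). If [f] selects up to [e], the map
    sending [x] to the intersection of [F x] with the open ball of radius [e]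
    around [f x] is again lower continuous with non-empty convex values
    ([lower_continuousI_ball]); selecting from it up to [e'] improves the error
    while moving [f] by no more than [e + e']. With errors [2^-n] this gives a
    uniformly Cauchy sequence of continuous maps into [C]. Completeness of [C]
    provides its pointwise limit, the uniform rate makes the limit continuous,
    and the limit lies in [F x] because [F x] is closed. The error is measured
    from points of [F x] in [E], and the iteration runs with values in [E] that
    happen to lie in [C]; the subspace topology of [C] enters only when
    the hypothesis on [F] is transported and when the limit is taken. *)

(** * Convex sets *)

Lemma convex_setP {R : realType} {E : lmodType R} {K : set E} {t : R}
    {u v : E} :
  @convex_set R E K -> K u -> K v -> 0 <= t -> t <= 1 ->
  K (t *: u + (1 - t) *: v).
Proof.
move=> cK Ku Kv t0 t1.
have t01 : Itv.spec (@Itv.num_sem R) (Itv.Real `[0%Z, 1%Z]) t.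
  by rewrite /Itv.num_sem/= realE t0/= in_itv/= t0 t1.
have /= := cK u v (Itv.Def t01) (mem_set Ku) (mem_set Kv).
by move=> /set_mem.
Qed.

(** By induction on the number of points: the new mean is the barycenter of the
    previous one and of the last point. Only the points of positive weight are
    asked to be in [K], since in a partition of unity the others are
    arbitrary. *)
Lemma convex_weighted_mean {R : realType} {E : lmodType R} {K : set E}
    {w : nat -> R} {y : nat -> E} {N : nat} :
  @convex_set R E K -> (forall k, 0 <= w k) ->
  (forall k, 0 < w k -> K (y k)) -> 0 < \sum_(k < N) w k ->
  K ((\sum_(k < N) w k)^-1 *: \sum_(k < N) w k *: y k).
Proof.
move=> cK w0 wK; elim: N => [|N IH]; first by rewrite big_ord0 ltxx.
rewrite !big_ord_recr /=.
set s := \sum_(k < N) w k in IH *; set z := \sum_(k < N) _ in IH *.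
have s0 : 0 <= s by apply: sumr_ge0.
have [wN0|wN0] := eqVneq (w N) 0.
  by rewrite wN0 scale0r !addr0; exact: IH.
have wN : 0 < w N by rewrite lt_def wN0 w0.
have [se|sn0] := eqVneq s 0.
  have -> : z = 0.
    apply: big1 => k _; have /eqP := se.
    rewrite psumr_eq0 // => /allP /(_ k (mem_index_enum _)) /= /eqP ->.
    by rewrite scale0r.
  by rewrite se !add0r scalerA mulVf // scale1r => _; exact: wK.
move=> sw; have sp : 0 < s by rewrite lt_def sn0.
have -> : (s + w N)^-1 *: (z + w N *: y N) =
    (s / (s + w N)) *: (s^-1 *: z) + (1 - s / (s + w N)) *: y N.
  rewrite scalerDr !scalerA; congr (_ *: _ + _ *: _); field=> //.
    by rewrite sn0 gt_eqF.
  by rewrite gt_eqF.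
apply: convex_setP => //; [exact: IH|exact: wK|..].
  by rewrite divr_ge0 // ltW.
by rewrite ler_pdivrMr // mul1r lerDl.
Qed.

Lemma convex_setI {R : realType} {E : lmodType R} {A B : set E} :
  @convex_set R E A -> @convex_set R E B -> @convex_set R E (A `&` B).
Proof.
move=> cA cB u v l /set_mem[Au Bu] /set_mem[Av Bv]; apply/mem_set.
by split; apply/set_mem; [apply: cA|apply: cB]; exact/mem_set.
Qed.

(** The [e]-neighborhood of a convex set is convex: the barycenter of
    approximating points approximates the barycenter, by the triangle
    inequality. *)
Lemma convex_set_ball {R : realType} {E : normedModType R} {A : set E}
    (e : R) : 0 < e ->
  @convex_set R E A -> @convex_set R E [set y | exists2 z, A z & `|z - y| < e].
Proof.
move=> e0 cA u v l /set_mem[a Aa au] /set_mem[b Ab bv]; apply/mem_set.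
exists (l%:num *: a + (1 - l%:num) *: b); first exact: convex_setP.
rewrite [X in X < _](_ : _ =
  `|l%:num *: (a - u) + (1 - l%:num) *: (b - v)|); last first.
  by congr `|_|; rewrite !scalerBr opprD addrACA.
have l0 : 0 <= l%:num by [].
have l1 : 0 <= 1 - l%:num by rewrite subr_ge0.
rewrite (le_lt_trans (ler_normD _ _)) // !normrZ !ger0_norm //.
have [->|ln0] := eqVneq l%:num 0.
  by rewrite mul0r add0r subr0 mul1r.
have lp : 0 < l%:num by rewrite lt_def ln0.
have -> : e = l%:num * e + (1 - l%:num) * e by ring.
by rewrite ltr_leD ?ltr_pM2l // ler_wpM2l // ltW.
Qed.

Lemma convex_open_ball {R : realType} {E : normedModType R} (a : E) (e : R) :
  0 < e -> @convex_set R E [set y | `|y - a| < e].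
Proof.
move=> e0.
rewrite (_ : mkset _ = [set y | exists2 z, [set a] z & `|z - y| < e]).
  apply: convex_set_ball => // u v l /set_mem -> /set_mem ->.
  by rewrite convmm; exact/mem_set.
apply/seteqP; split=> y /=; first by exists a => //; rewrite distrC.
by move=> [_ -> ya]; rewrite distrC.
Qed.

(** * Continuous functions on a separable metrizable space *)

Lemma compatible_metric_ge0 {R : realType} {X : topologicalType}
    {d : X -> X -> R} (x y : X) : compatible_metric d -> 0 <= d x y.
Proof.
move=> [[d0 dC dD] _]; have := dD x y x.
by rewrite (dC y x) (d0 x x).2 //; lra.
Qed.

Lemma compatible_metric_nbhsP {R : realType} {X : topologicalType}
    {d : X -> X -> R} (x : X) (A : set X) : compatible_metric d ->
  nbhs x A <-> exists2 e, 0 < e & [set y | d x y < e] `<=` A.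
Proof. by move=> [_ ->]. Qed.

Lemma compatible_metric_continuous {R : realType} {X : topologicalType}
    {d : X -> X -> R} (a : X) : compatible_metric d -> continuous (d a).
Proof.
move=> cd x; apply/cvgrPdist_lt => e e0.
apply/(compatible_metric_nbhsP _ _ cd); exists e => // y /= xy.
have [[_ dC dD] _] := cd.
have := dD a x y; have := dD a y x; rewrite (dC y x).
by rewrite ltr_norml => ? ?; lra.
Qed.

Lemma continuous_positive_part {R : realType} {X : topologicalType}
    {f : X -> R} : continuous f -> continuous (fun x => Num.max 0 (f x)).
Proof.
move=> cf x; apply: (@continuous_max _ _ (fun=> 0) f); last exact: cf.
exact: cst_continuous.
Qed.

(** A countable family of bumps that plays the role of the Lindelof property.
    Each bump is [x |-> max 0 (1/(m+1) - d a x)] for a point [a] of a countable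
    dense set and an integer [m], kept only when its ball is contained in one
    member of the cover and replaced by [0] otherwise; the pairs [(a, m)] are
    numbered through [pickle]. The bound by [1] is what makes
    [locally_finite_refinement] applicable. *)
Lemma separable_subordinate_functions {R : realType} {X : topologicalType}
    {I : Type} (U : I -> set X) {d : X -> X -> R} :
  separable X -> compatible_metric d ->
  (forall i, open (U i)) -> (forall x, exists i, U i x) ->
  exists phi : nat -> X -> R,
    [/\ forall n, continuous (phi n),
        forall n x, 0 <= phi n x <= 1,
        forall x, exists n, 0 < phi n x &
        forall n x, 0 < phi n x ->
          exists i, [set z | 0 < phi n z] `<=` U i].
Proof.
move=> [D /countable_injP[c cinj] Ddense] cd oU covU.
(* Several pairs (m, a) must not share a number: c is injective on D. *)
pose good n m a := D a /\ exists i,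
  n = pickle (c a, m) /\ [set z | d a z < m.+1%:R^-1] `<=` U i.
have /choice[phi phiP] n : exists p : X -> R,
    [/\ continuous p, forall x, 0 <= p x <= 1,
        forall m a, good n m a -> forall z, d a z < m.+1%:R^-1 -> 0 < p z &
        forall x, 0 < p x -> exists i, [set z | 0 < p z] `<=` U i].
  have [[m [a ga]]|nogood] := pselect (exists m a, good n m a); last first.
    exists (fun=> 0); split => //; first by move=> x; exact: cst_continuous.
      by move=> x; rewrite lexx ler01.
      by move=> m a ga; case: nogood; exists m, a.
    by move=> x; rewrite ltxx.
  have [Da [i [nE aU]]] := ga.
  have pos z : (0 < Num.max 0 (m.+1%:R^-1 - d a z)) = (d a z < m.+1%:R^-1).
    by rewrite lt_max ltxx subr_gt0.
  exists (fun z => Num.max 0 (m.+1%:R^-1 - d a z)); split.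
  - apply: continuous_positive_part => x.
    apply: cvgB; first exact: cvg_cst.
    exact: compatible_metric_continuous.
  - move=> x; rewrite le_max lexx ge_max ler01 /= lerBlDr.
    rewrite (@le_trans _ _ 1) ?invf_le1 ?ler1n // lerDl.
    exact: compatible_metric_ge0.
  - move=> m' a' [Da' [_ [nE' _]]] z.
    move: nE'; rewrite nE => /(pcan_inj pickleK)[cE <-].
    by rewrite pos (cinj a a') ?inE.
  - by move=> x _; exists i => z /=; rewrite pos; exact: aU.
exists phi; split.
- by move=> n; have [] := phiP n.
- by move=> n; have [] := phiP n.
- move=> x; have [i Uix] := covU x.
  have : nbhs x (U i) by apply: open_nbhs_nbhs.
  move=> /(compatible_metric_nbhsP _ _ cd)[e e0 xeU].
  (* A dense point within 1/(m+1) of x has a ball of that radius which contains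
     x and, as 2/(m+1) < e, stays within e of x. *)
  have [m me] : exists m : nat, m.+1%:R^-1 < e / 2.
    have e2 : 0 < e / 2 by rewrite divr_gt0.
    have [m _ /(_ m (leqnn m))] := near_infty_natSinv_lt (PosNum e2).
    by exists m.
  have [a [xa Da]] : [set y | d x y < m.+1%:R^-1]° `&` D !=set0.
    apply: Ddense; last exact: open_interior.
    exists x; apply/(compatible_metric_nbhsP _ _ cd); exists m.+1%:R^-1 => //.
  have {}xa : d x a < m.+1%:R^-1 by exact: (interior_subset xa).
  have [[_ dC dD] _] := cd.
  exists (pickle (c a, m)); have [_ _ + _] := phiP (pickle (c a, m)).
  move=> /(_ m a); apply; last by rewrite dC.
  split=> //; exists i; split=> // z /= az; apply: xeU => /=.
  rewrite (le_lt_trans (dD x a z)) // [ltRHS]splitr ltrD //.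
    exact: lt_trans xa me.
  exact: lt_trans az me.
- by move=> n; have [] := phiP n.
Qed.

(** Subtracting from [phi n] the multiple [n * \sum_(k < n) phi k] leaves the
    first positive function at [x] untouched, so some [psi n] is still positive
    at [x]. If [phi k] exceeds [c > 0] on a neighborhood of [x], then for every
    [n > k] such that [n * c >= 1] the subtracted term is at least [1], hence
    [psi n] vanishes there.

    The bound [N] depends on [x], which is enough to define the sum of the
    family as a finite sum near each point. *)
Lemma locally_finite_refinement {R : realType} {X : topologicalType}
    {phi : nat -> X -> R} :
  (forall n, continuous (phi n)) -> (forall n x, 0 <= phi n x <= 1) ->
  (forall x, exists n, 0 < phi n x) ->
  exists psi : nat -> X -> R,
    [/\ forall n, continuous (psi n),
        forall n x, 0 <= psi n x,
        forall n x, 0 < psi n x -> 0 < phi n x &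
        forall x, exists2 N, 0 < \sum_(k < N) psi k x &
          \forall z \near x, forall n, (N <= n)%N -> psi n z = 0].
Proof.
move=> cphi phi01 phip.
have phi0 n x : 0 <= phi n x by case/andP: (phi01 n x).
have phi1 n x : phi n x <= 1 by case/andP: (phi01 n x).
pose psi n x := Num.max 0 (phi n x - n%:R * \sum_(k < n) phi k x).
have sum0 n x : 0 <= \sum_(k < n) phi k x by apply: sumr_ge0.
have psi0 n x : 0 <= psi n x by rewrite /psi le_max lexx.
exists psi; split=> //.
- move=> n; apply: continuous_positive_part => x.
  apply: cvgB; first exact: cphi.
  apply: cvgM; first exact: cvg_cst.
  by apply: cvg_big => [|k _]; [exact: add_continuous|exact: cphi].
- move=> n x; rewrite /psi lt_max ltxx /= subr_gt0; apply: le_lt_trans.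
  by apply: mulr_ge0; rewrite ?ler0n ?sum0.
move=> x; have [n0 n0p n0min] := ex_minnP (phip x).
have [M Mp] : exists M : nat, (phi n0 x / 2)^-1 < M%:R.
  by exists (Num.truncn (phi n0 x / 2)^-1).+1; rewrite truncnS_gt.
exists (maxn M n0.+1).
  rewrite (bigD1 (Ordinal (leq_maxr M n0.+1))) //=.
  rewrite ltr_pwDl ?sumr_ge0 // /psi lt_max ltxx /= big1 ?mulr0 ?subr0 //.
  move=> k _; apply/eqP; rewrite eq_le phi0 andbT leNgt; apply/negP => kp.
  by have := n0min _ kp; rewrite leqNgt ltn_ord.
(* The neighborhood of x on which the earlier function phi n0 stays above half
   of its value at x. *)
have half : phi n0 x / 2 < phi n0 x by lra.
have /cvgr_gt /(_ _ half) := cphi n0 x.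
apply: filterS => z zp n; rewrite geq_max => /andP[Mn n0n].
apply/max_idPl; rewrite subr_le0 (le_trans (phi1 _ _)) //.
have h : 0 < phi n0 x / 2 by rewrite divr_gt0.
have Mn' : (phi n0 x / 2)^-1 <= n%:R.
  by rewrite (le_trans (ltW Mp)) // ler_nat.
rewrite -[leLHS](mulVf (lt0r_neq0 h)) ler_pM ?invr_ge0 ?(ltW h) //.
apply: (le_trans (ltW zp)).
by rewrite (bigD1 (Ordinal n0n)) //= lerDl sumr_ge0.
Qed.

(** * Approximate selections *)

(** Stated for arbitrary set-valued maps, because the maps met in the iteration
    of approximate selections do not have closed values. *)
Definition lower_continuous {X Y : topologicalType} (G : X -> set Y) :=
  forall U, open U -> open [set x | G x `&` U !=set0].

(** The centers [c] range over [C] itself, so the means are in [C] as well as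
    in the [e]-neighborhood of the values of [G]. *)
Lemma approximate_selection {R : realType} {X : topologicalType}
    {E : normedModType R} {C : set E} {G : X -> set E} {d : X -> X -> R}
    {e : R} :
  separable X -> compatible_metric d -> @convex_set R E C ->
  lower_continuous G -> (forall x, @convex_set R E (G x)) ->
  (forall x, G x !=set0) -> (forall x, G x `<=` C) -> 0 < e ->
  exists f : X -> E, [/\ continuous f, forall x, C (f x) &
    forall x, exists2 y, G x y & `|y - f x| < e].
Proof.
move=> sX cd cC lG cG G0 GC e0.
pose U (c : C) := [set x | G x `&` ball (\val c) e !=set0].
have [|phi [cphi phi01 phip phiU]] := separable_subordinate_functions U sX cd
  (fun c => lG _ (ball_open _ _)).
  move=> x; have [y Gy] := G0 x.
  exists (exist _ y (mem_set (GC x _ Gy))), y; split=> //=; exact: ballxx.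
have [psi [cpsi psi0 psiphi psiN]] := locally_finite_refinement cphi phi01 phip.
have /choice[y yP] n : exists y : E, forall x, 0 < phi n x ->
    C y /\ exists2 z, G x z & `|z - y| < e.
  have [[x /phiU[c cU]]|no] := pselect (exists x, 0 < phi n x); last first.
    by exists 0 => x phin; case: no; exists x.
  exists (\val c) => z /cU[v [Gv]]; rewrite -ball_normE /= distrC => vc.
  by split; [exact: set_mem (valP c)|exists v].
have /choice[N NP] x : exists N, 0 < \sum_(k < N) psi k x /\
    \forall z \near x, forall n, (N <= n)%N -> psi n z = 0.
  by have [N] := psiN x; exists N.
(* As N x depends on x, the normalized sum h is considered with any number of
   terms: near x, the values h (N x) z and h (N z) z agree. *)
pose h n x := (\sum_(k < n) psi k x)^-1 *: \sum_(k < n) psi k x *: y k.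
have hN n m x : (n <= m)%N -> (forall k, (n <= k)%N -> psi k x = 0) ->
    h m x = h n x.
  move=> nm psik; rewrite /h -!(big_mkord predT (fun k => psi k x)).
  rewrite -!(big_mkord predT (fun k => psi k x *: y k)).
  rewrite !(@big_cat_nat _ _ _ n 0%N m) //=.
  have -> : \sum_(n <= k < m) psi k x = 0.
    by rewrite big_nat big1 // => k /andP[nk _]; exact: psik.
  have -> : \sum_(n <= k < m) psi k x *: y k = 0.
    by rewrite big_nat big1 // => k /andP[nk _]; rewrite psik // scale0r.
  by rewrite !addr0.
exists (fun x => h (N x) x); split.
- move=> x; have [sx nx] := NP x.
  have hE : \forall z \near x, h (N x) z = h (N z) z.
    apply: filterS nx => z nz; have [_ /nbhs_singleton nz'] := NP z.
    by case/orP: (leq_total (N x) (N z)) => le; [rewrite (hN _ _ _ le nz)|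
      rewrite (hN _ _ _ le nz')].
  apply: cvg_trans (near_eq_cvg hE) _.
  apply: cvgZ; last first.
    apply: cvg_big => [|k _]; first exact: add_continuous.
    by apply: cvgZr_tmp; exact: cpsi.
  apply: (@cvgV _ _ _ _ (fun z => \sum_(k < N x) psi k z)).
    by rewrite gt_eqF.
  by apply: cvg_big => [|k _]; [exact: add_continuous|exact: cpsi].
- move=> x; have [sx _] := NP x.
  by apply: (@convex_weighted_mean R E C (psi^~ x) y) => // k /psiphi /yP[].
- move=> x; have [sx _] := NP x.
  pose K := [set v | exists2 z, G x z & `|z - v| < e].
  apply: (@convex_weighted_mean R E K (psi^~ x) y) => //.
    exact: convex_set_ball.
  by move=> k /psiphi /yP[].
Qed.

(** The open ball matters here: a point of [G x] strictly within [e] of [f x]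
    leaves some room, shared between the displacement of that point and the
    variation of [f]. *)
Lemma lower_continuousI_ball {R : realType} {X : topologicalType}
    {E : normedModType R} {G : X -> set E} {f : X -> E} (e : R) :
  lower_continuous G -> continuous f ->
  lower_continuous (fun x => G x `&` [set y | `|y - f x| < e]).
Proof.
move=> lG cf U oU; rewrite openE => x [y [[Gy /= yfx] Uy]].
(* Half of the room goes to each of the two displacements. *)
pose r := (e - `|y - f x|) / 2.
have r0 : 0 < r by rewrite divr_gt0 // subr_gt0.
have /cvgrPdist_lt /(_ r r0) fr := cf x.
have : nbhs x [set z | G z `&` (U `&` ball y r) !=set0].
  apply: open_nbhs_nbhs; split; last first.
    by exists y; split=> //; split=> //; exact: ballxx.
  by apply: lG; apply: openI => //; exact: ball_open.
apply: filterS2 fr => z fz [v [Gv [Uv]]]; rewrite -ball_normE /= => yv.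
exists v; split=> //; split=> //=.
have -> : v - f z = (v - y) + (y - f x) + (f x - f z) by rewrite !addrA !subrK.
rewrite (le_lt_trans (ler_normD _ _)) //.
have := ler_normD (v - y) (y - f x); rewrite (distrC v y).
by move: yv fz; rewrite /r /=; lra.
Qed.

(** Selecting from [G x] intersected with the ball of radius [e] around [f x]
    gives, at each [x], one point of [G x] that is both [e]-close to [f x] and
    [e']-close to the new map; hence the bound [e + e'] on their distance. *)
Lemma approximate_selection_near {R : realType} {X : topologicalType}
    {E : normedModType R} {C : set E} {G : X -> set E} {d : X -> X -> R}
    {f : X -> E} {e e' : R} :
  separable X -> compatible_metric d -> @convex_set R E C ->
  lower_continuous G -> (forall x, @convex_set R E (G x)) ->
  (forall x, G x `<=` C) -> continuous f ->
  (forall x, exists2 y, G x y & `|y - f x| < e) -> 0 < e' ->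
  exists g : X -> E, [/\ continuous g, forall x, C (g x),
    forall x, exists2 y, G x y & `|y - g x| < e' &
    forall x, `|g x - f x| <= e + e'].
Proof.
move=> sX cd cC lG cG GC cf Gf e'0.
have [x|x|x|g [cg Cg Gg]] := approximate_selection (e := e') sX cd cC
  (lower_continuousI_ball e lG cf) _ _ _ e'0.
- have [y _ yf] := Gf x; apply: convex_setI => //.
  exact: convex_open_ball (le_lt_trans _ yf).
- by have [y Gy yf] := Gf x; exists y.
- by move=> y [/GC].
exists g; split=> // x; have [y [Gy yf] yg] := Gg x; first by exists y.
rewrite (le_trans (ler_distD y _ _)) // addrC lerD ?(ltW yf) //.
by rewrite distrC ltW.
Qed.

(** The factor [4] bounds the tail of the geometric series: the [n]-th step
    moves by at most [2^-n + 2^-(n+1)], and these displacements sum to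
    [3 * 2^-n]. *)
Lemma approximate_selection_sequence {R : realType} {X : topologicalType}
    {E : normedModType R} {C : set E} {G : X -> set E} {d : X -> X -> R} :
  separable X -> compatible_metric d -> @convex_set R E C ->
  lower_continuous G -> (forall x, @convex_set R E (G x)) ->
  (forall x, G x !=set0) -> (forall x, G x `<=` C) ->
  exists f : nat -> X -> E, [/\ forall n, continuous (f n),
    forall n x, C (f n x),
    forall n x, exists2 y, G x y & `|y - f n x| < 2^-1 ^+ n &
    forall n k x, `|f (n + k)%N x - f n x| <= 4 * 2^-1 ^+ n].
Proof.
move=> sX cd cC lG cG G0 GC.
have half n : 0 < 2^-1 ^+ n :> R by rewrite exprn_gt0.
pose P n (f : X -> E) := [/\ continuous f, forall x, C (f x) &
  forall x, exists2 y, G x y & `|y - f x| < 2^-1 ^+ n].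
have [f0 Pf0] := approximate_selection sX cd cC lG cG G0 GC (half 0).
have /choice[next nextP] (p : nat * (X -> E)) : exists g, P p.1 p.2 ->
    P p.1.+1 g /\ forall x, `|g x - p.2 x| <= 2^-1 ^+ p.1 + 2^-1 ^+ p.1.+1.
  have [[cf Cf Gf]|nP] := pselect (P p.1 p.2); last by exists p.2 => /nP.
  have [g [cg Cg Gg gf]] :=
    approximate_selection_near sX cd cC lG cG GC cf Gf (half p.1.+1).
  by exists g.
pose f := fix f n := if n is m.+1 then next (m, f m) else f0.
have Pf n : P n (f n).
  by elim: n => [//|n Pn]; have [] := nextP (n, f n) Pn.
have fS n x : `|f n.+1 x - f n x| <= 2^-1 ^+ n + 2^-1 ^+ n.+1.
  by have [_] := nextP (n, f n) (Pf n); exact.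
exists f; split; try by move=> n; have [] := Pf n.
move=> n k x.
(* Keeping the unspent part of the tail on the left gives an inequality that is
   stable by induction on k. *)
suff : `|f (n + k)%N x - f n x| + 4 * 2^-1 ^+ (n + k) <= 4 * 2^-1 ^+ n.
  by have := half (n + k)%N; lra.
elim: k => [|k IH]; first by rewrite addn0 subrr normr0 add0r.
rewrite addnS; apply: le_trans IH.
have -> : f (n + k).+1 x - f n x =
  (f (n + k).+1 x - f (n + k)%N x) + (f (n + k)%N x - f n x).
  by rewrite addrA subrK.
have := ler_normD (f (n + k).+1 x - f (n + k)%N x) (f (n + k)%N x - f n x).
have := fS (n + k)%N x; have := half (n + k)%N; rewrite exprS; lra.
Qed.

(** * Passage to the limit *)

Lemma exists_geometric_half_lt {R : realType} (c : R) {e : R} :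
  0 < e -> exists n, c * 2^-1 ^+ n < e.
Proof.
move=> e0; have h1 : `|2^-1 : R| < 1 by rewrite ger0_norm // invf_lt1 // ltr1n.
have /cvgr_lt /(_ e e0) [n _ /(_ n (leqnn n)) ne] := cvg_geometric c h1.
by exists n.
Qed.

Lemma continuous_geometric_limit {R : realType} {X : topologicalType}
    {E : normedModType R} {f : nat -> X -> E} {g : X -> E} {c : R} :
  (forall n, continuous (f n)) ->
  (forall n x, `|g x - f n x| <= c * 2^-1 ^+ n) -> continuous g.
Proof.
move=> cf gf x; apply/cvgrPdist_lt => e e0.
have e3 : 0 < e / 3 by rewrite divr_gt0.
have [n ne] := exists_geometric_half_lt c e3.
have /cvgrPdist_lt /(_ _ e3) := cf n x; apply: filterS => z fz.
have := gf n x; have := gf n z; rewrite (distrC (g z)).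
have := ler_distD (f n x) (g x) (g z); have := ler_distD (f n z) (f n x) (g z).
by lra.
Qed.

Theorem theorem5p2 (R : realType) (E : normedModType R) (X : topologicalType)
    (C : set E) (F : X -> Fconv C) :
  polish R X ->
  @convex_set R E C ->
  complete_set C ->
  continuous F ->
  exists f : X -> C, continuous f /\ forall x, (\val (F x) : set C) (f x).
Proof.
move=> [sX [d cd _]] cC compC /lower_continuousP lF.
pose G x : set E := [set \val v | v in (\val (F x) : set C)].
have FP x : [/\ (\val (F x) : set C) !=set0, closed (\val (F x) : set C) &
    @convex_set R E (G x)].
  exact: set_mem (valP (F x)).
have lG : lower_continuous G.
  move=> U oU; rewrite (_ : mkset _ =
      [set x | (\val (F x) : set C) `&` (\val @^-1` U) !=set0]); last first.
    apply/seteqP; split=> x /=; first by move=> [_ [[v Fv <-] Uv]]; exists v.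
    by move=> [v [Fv Uv]]; exists (\val v); split=> //; exists v.
  apply: lF; apply: open_comp => // v _; exact: initial_continuous.
have [x|x|x|f [cf Cf Gf fk]] :=
  approximate_selection_sequence sX cd cC lG _ _ _.
- by have [] := FP x.
- by have [[v Fv] _ _] := FP x; exists (\val v), v.
- by move=> _ [v _ <-]; exact: set_mem (valP v).
have /choice[g gP] x :
    exists l : C, forall n, `|\val l - f n x| <= 4 * 2^-1 ^+ n.
  pose u n : C := exist _ (f n x) (mem_set (Cf n x)).
  have [e e0|l ul] := compC u.
    have e2 : 0 < e / 2 by rewrite divr_gt0.
    have [n ne] := exists_geometric_half_lt 4 e2.
    exists ([set k | (n <= k)%N], [set k | (n <= k)%N]).
      by split; exists n.
    move=> [p q] [/= np nq]; rewrite /norm_dist /=.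
    have := ler_distD (f n x) (f p x) (f q x); rewrite (distrC (f n x)).
    have := fk n (p - n)%N x; have := fk n (q - n)%N x; rewrite !subnKC //.
    by lra.
  exists l => n; apply/ler_addgt0Pr => e e0.
  have /cvgr_lt /(_ e e0) [m _ um] := ul.
  have := um (n + m)%N (leq_addl n m); have := fk n m x.
  rewrite /norm_dist /= => fnm fml.
  rewrite (le_trans (ler_distD (f (n + m)%N x) _ _)) // addrC lerD //.
  by rewrite distrC ltW.
exists g; split.
  apply: continuous_comp_initial.
  exact: (continuous_geometric_limit cf (fun n x => gP x n)).
move=> x; have [_ clF _] := FP x; apply: clF => B /nbhs_ballP[e /= e0 gB].
(* The limit is within 4 * 2^-n of f n x and some point of F x is within 2^-n of
   it: five times 2^-n in total. *)
have e2 : 0 < e / 5 by rewrite divr_gt0.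
have [n ne] := exists_geometric_half_lt 1 e2.
have [_ [v Fv <-] vf] := Gf n x.
exists v; split=> //; apply: gB; rewrite -initial_ballE /= -ball_normE /=.
have := ler_distD (f n x) (\val (g x)) (\val v); rewrite (distrC (f n x)).
by have := gP x n; move: ne vf; lra.
Qed.
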